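(* Let $n=2k$ for some integer $k\ge 2$, and put $l=\left\lfloor \frac{n-4}{4}\right\rfloor$. Then $$\psi_4(2k)=(l+1)k^2-(2l+3)(l+1)k+\frac{4l^3+15l^2+20l+9}{3}.$$
   Context: The wheel $W_n$ is the join of the cycle $C_n$ (the outer cycle) and a single vertex: $V(W_n)=\{v,v_1,\dots,v_n\}$ and $E(W_n)=\{vv_i,\ v_iv_{i+1} : 1\le i\le n\}$ with subscripts modulo $n$; the outer cycle $C_n$ has edges $v_iv_{i+1}$. A signed graph $\Sigma=(G,\sigma)$ is a graph $G$ together with a function $\sigma:E(G)\to\{+1,-1\}$; an edge $e$ is negative if $\sigma(e)=-1$. Switching $\Sigma$ at a vertex $u$ changes the sign of every edge incident to $u$. Two signed graphs are isomorphic if there is a graph isomorphism between their underlying graphs preserving edge signs. Two signed graphs are switching isomorphic if one is isomorphic to a signed graph obtained from the other by a sequence of switchings. $(W_n,\sigma)^o$ denotes a signed wheel all of whose negative edges lie on the outer cycle $C_n$. For $0\le p\le n$, $\psi_p(n)$ denotes the number of switching non-isomorphic signed wheels of the form $(W_n,\sigma)^o$ with exactly $p$ negative edges (the number of equivalence classes of such signed wheels under switching isomorphism). *)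

(* Defs.v *)
From mathcomp Require Import all_boot.

Set Implicit Arguments.
Unset Strict Implicit.
Unset Printing Implicit Defensive.

Record graph := Graph {
  vertex :> finType;
  adj : rel vertex;
  adj_sym : symmetric adj;
  adj_irr : irreflexive adj }.

Definition edges (G : graph) : {set {set G}} :=
  [set [set xy.1; xy.2] | xy in [set xy : G * G | adj xy.1 xy.2]].

Notation edge G := {e : {set vertex G} | e \in edges G}.

(* Signs are encoded by booleans through b |-> (-1) ^ b: [true] is -1, so a   *)
(* negative edge is one mapped to [true] and changing a sign is negation.     *)
Notation signature G := {ffun edge G -> bool}.

Definition negative_edges (G : graph) (s : signature G) : {set edge G} :=
  [set e | s e].

Definition switch (G : graph) (u : G) (s : signature G) : signature G :=
  [ffun e : edge G => if u \in val e then ~~ s e else s e].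

Definition switching_equivalent (G : graph) : rel (signature G) :=
  connect (fun s t : signature G => [exists u : G, t == switch u s]).

Definition is_signed_iso (G H : graph) (s : signature G) (t : signature H)
    (f : {ffun G -> H}) : bool :=
  [&& injectiveb f, [forall y : H, y \in codom f],
      [forall x : G, forall y : G, adj (f x) (f y) == adj x y]
    & [forall e : edge G, forall e' : edge H,
        (val e' == f @: val e) ==> (t e' == s e)]].

Definition isomorphic (G H : graph) (s : signature G)
    (t : signature H) : bool :=
  [exists f : {ffun G -> H}, is_signed_iso s t f].

(* Only one direction is stated; the relation is symmetric, as shown below.   *)
Definition switching_isomorphic (G H : graph) (s : signature G)
    (t : signature H) : bool :=
  [exists s' : signature G, switching_equivalent s s' && isomorphic s' t].

(* The hub v is [None] and v_i is [Some i], with indices in {0, ..., n-1}.    *)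
(* [ordS] is the successor modulo n. The condition [i != j] only matters for  *)
(* n = 1; the graph is the wheel W_n when n >= 3.                             *)
Definition wheel_adj (n : nat) : rel (option 'I_n) := fun x y =>
  match x, y with
  | None, None => false
  | Some i, Some j => (i != j) && ((j == ordS i) || (i == ordS j))
  | _, _ => true
  end.

Lemma wheel_adj_sym n : symmetric (@wheel_adj n).
Proof. by move=> [i|] [j|] //=; rewrite eq_sym orbC. Qed.

Lemma wheel_adj_irr n : irreflexive (@wheel_adj n).
Proof. by move=> [i|] //=; rewrite eqxx. Qed.

Definition wheel (n : nat) : graph :=
  Graph (@wheel_adj_sym n) (@wheel_adj_irr n).

Definition outer_cycle (n : nat) : {set {set wheel n}} :=
  [set [set Some i; Some (ordS i)] | i : 'I_n].

Definition outer_signed_wheels (p n : nat) : {set signature (wheel n)} :=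
  [set s | (#|negative_edges s| == p)
           && [forall e in negative_edges s, val e \in outer_cycle n]].

Definition psi (p n : nat) : nat :=
  #|equivalence_partition (@switching_isomorphic (wheel n) (wheel n))
      (outer_signed_wheels p n)|.

(* [equivalence_partition] is the set of classes of an equivalence relation:  *)
(* the facts below establish that switching isomorphism is one.               *)

Lemma is_signed_isoP (G H : graph) (s : signature G) (t : signature H)
    (f : {ffun G -> H}) :
  reflect [/\ bijective f, forall x y, adj (f x) (f y) = adj x y
            & forall (e : edge G) (e' : edge H),
                val e' = f @: val e -> t e' = s e]
          (is_signed_iso s t f).
Proof.
apply: (iffP and4P) => [[/injectiveP fi /forallP fs /forallP fa /forallP fe]|].
  split=> [|x y|e e' E]; last 2 first.
  - by apply/eqP; apply: (forallP (fa x)).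
  - by apply/eqP; move/forallP/(_ e')/implyP: (fe e); apply; apply/eqP.
  exists (fun y => iinv (fs y)) => x; last exact: f_iinv.
  by apply: fi; rewrite f_iinv.
move=> [fb fa fe]; split.
- exact/injectiveP/bij_inj.
- by apply/forallP=> y; case: fb => g _ gK; rewrite -(gK y) codom_f.
- by apply/forallP=> x; apply/forallP=> y; rewrite fa.
- apply/forallP=> e; apply/forallP=> e'; apply/implyP=> /eqP E.
  by rewrite (fe e e').
Qed.

Lemma edge_imset (G H : graph) (f : G -> H) (e : edge G) :
  (forall x y, adj (f x) (f y) = adj x y) -> f @: val e \in edges H.
Proof.
move=> fa; case: e => e /= /imsetP[[x y]]; rewrite inE /= => xy ->.
rewrite imsetU1 imset_set1; apply/imsetP.
by exists (f x, f y); rewrite ?inE ?fa.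
Qed.

Lemma isomorphic_refl (G : graph) (s : signature G) : isomorphic s s.
Proof.
apply/existsP; exists [ffun x => x]; apply/is_signed_isoP; split.
- by exists id => x; rewrite ffunE.
- by move=> x y; rewrite !ffunE.
- move=> e e' E; congr (s _); apply: val_inj; rewrite E -[RHS]imset_id.
  by apply: eq_imset => x; rewrite ffunE.
Qed.

Lemma isomorphic_sym (G H : graph) (s : signature G) (t : signature H) :
  isomorphic s t -> isomorphic t s.
Proof.
move=> /existsP[f /is_signed_isoP[[g fK gK] fa fe]].
apply/existsP; exists (finfun g); apply/is_signed_isoP; split.
- by exists f => x; rewrite ffunE.
- by move=> x y; rewrite !ffunE -fa !gK.
- move=> e e' E; symmetry; apply: fe; rewrite E -imset_comp -[LHS]imset_id.
  by apply: eq_imset => x; rewrite /= ffunE gK.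
Qed.

Lemma isomorphic_trans (G H K : graph) (s : signature G) (t : signature H)
    (u : signature K) :
  isomorphic s t -> isomorphic t u -> isomorphic s u.
Proof.
move=> /existsP[f /is_signed_isoP[fb fa fe]].
move=> /existsP[g /is_signed_isoP[gb ga ge]].
apply/existsP; exists [ffun x => g (f x)]; apply/is_signed_isoP; split.
- apply: (eq_bij (bij_comp gb fb)) => x; by rewrite ffunE.
- by move=> x y; rewrite !ffunE ga fa.
- move=> e e' E.
  pose fe' : edge H := exist (fun e => e \in edges H) _ (edge_imset e fa).
  rewrite -(fe e fe') //; apply: ge.
  by rewrite E /= -imset_comp; apply: eq_imset => x; rewrite ffunE.
Qed.

Lemma switchK (G : graph) (u : G) : involutive (switch u).
Proof.
move=> s; apply/ffunP=> e; rewrite !ffunE.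
by case: (u \in _) => //; rewrite negbK.
Qed.

Lemma switching_equivalent_sym (G : graph) :
  symmetric (@switching_equivalent G).
Proof.
apply: sym_connect_sym => s t.
by apply/existsP/existsP => -[u /eqP->]; exists u; rewrite switchK.
Qed.

Lemma switching_equivalent_pullback (G H : graph) (s : signature G)
    (t t' : signature H) :
  isomorphic s t -> switching_equivalent t t' ->
  exists2 s', switching_equivalent s s' & isomorphic s' t'.
Proof.
move=> st /connectP[p]; elim: p s t st => [|t1 p IH] s t st /=.
  by move=> _ ->; exists s => //; exact: connect0.
move=> /andP[/existsP[u /eqP E] tp] Et'.
have [g gb] : exists g : H -> G, isomorphic (switch (g u) s) t1.
  move/existsP: st => [f /is_signed_isoP[[g fK gK] fa fe]].
  exists g; apply/existsP; exists f; apply/is_signed_isoP; split => //.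
    by exists g.
  move=> e e' Ee; rewrite E !ffunE (fe _ _ Ee).
  suff -> : (u \in val e') = (g u \in val e) by [].
  by rewrite Ee -{1}(gK u) mem_imset //; exact: can_inj fK.
have [s' ss' s't'] := IH _ _ gb tp Et'.
exists s' => //; apply: connect_trans ss'; apply: connect1.
by apply/existsP; exists (g u).
Qed.

Lemma switching_isomorphic_refl (G : graph) (s : signature G) :
  switching_isomorphic s s.
Proof.
by apply/existsP; exists s; rewrite isomorphic_refl andbT; exact: connect0.
Qed.

Lemma switching_isomorphic_sym (G H : graph) (s : signature G)
    (t : signature H) :
  switching_isomorphic s t -> switching_isomorphic t s.
Proof.
move=> /existsP[s' /andP[ss' /isomorphic_sym ts']].
rewrite switching_equivalent_sym in ss'.
have [t' tt' t's] := switching_equivalent_pullback ts' ss'.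
by apply/existsP; exists t'; rewrite tt'.
Qed.

Lemma switching_isomorphic_trans (G H K : graph) (s : signature G)
    (t : signature H) (u : signature K) :
  switching_isomorphic s t -> switching_isomorphic t u ->
  switching_isomorphic s u.
Proof.
move=> /existsP[s' /andP[ss' s't]] /existsP[t' /andP[tt' t'u]].
have [s2 s's2 s2t'] := switching_equivalent_pullback s't tt'.
apply/existsP; exists s2; rewrite (isomorphic_trans s2t' t'u) andbT.
exact: connect_trans ss' s's2.
Qed.

Lemma switching_isomorphic_equiv (G : graph) :
  equivalence_rel (@switching_isomorphic G G).
Proof.
move=> s t u; split=> [|st]; first exact: switching_isomorphic_refl.
apply/idP/idP; apply: switching_isomorphic_trans => //.
exact: switching_isomorphic_sym.
Qed.

(* Main.v *)
(* The signs of the triangles through the hub are invariant under switching,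
   and on a signed wheel whose spokes are all positive they are the signs of the
   rim edges. Since every automorphism of W_n, n >= 4, fixes the hub, psi_4(n)
   is the number of orbits of the dihedral group of order 2n on the 4-subsets of
   Z/n. Burnside's lemma counts them when n = 2k. The identity fixes C(2k, 4)
   subsets. Each of the 2k reflections and the half turn is an involution with
   at most two fixed points, hence fixes C(k, 2) subsets. For even k, each of the
   two quarter turns fixes k / 2 subsets. No other rotation fixes a 4-subset. *)
Require Import Defs.
From mathcomp Require Import all_boot all_order all_algebra all_fingroup.
From mathcomp Require Import zify ring lra.

Set Implicit Arguments.
Unset Strict Implicit.
Unset Printing Implicit Defensive.
Import GRing.Theory Num.Theory.

(** On X the map f factors through g, so f @: X is an image of g @: X. Used in both directions, this
    compares the number of switching classes with the number of orbits. *)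
Lemma leq_card_imset_fibers (aT rT rT' : finType) (f : aT -> rT)
    (g : aT -> rT') (X : {set aT}) :
  {in X &, forall x y, g x = g y -> f x = f y} -> #|f @: X| <= #|g @: X|.
Proof.
move=> fg; have [->|[x0 _]] := set_0Vmem X; first by rewrite !imset0 !cards0.
pose h y := if [pick x in X | g x == y] is Some x then f x else f x0.
suff -> : f @: X = h @: (g @: X) by exact: leq_imset_card.
rewrite -imset_comp; apply: eq_in_imset => x xX /=; rewrite /h.
case: pickP => [y /andP[yX /eqP E]|/(_ x)]; first exact: fg.
by rewrite xX eqxx.
Qed.

(** * Quadruples stable under an involution *)

Section Involution.
Variables (T : finType) (s : T -> T).
Hypothesis sK : involutive s.

Let F := [set x | s x == x].
(** One representative of each two-element orbit, the one of smaller rank, so that T is the disjoint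
    union of R, s @: R and F. *)
Let R := [set x | enum_rank x < enum_rank (s x)].

Lemma card_involution : #|T| = 2 * #|R| + #|F|.
Proof.
have D : [disjoint R & s @: R].
  rewrite disjoints_subset; apply/subsetP=> x; rewrite !inE => xR.
  apply/imsetP=> -[y]; rewrite inE => yR E; move: xR; rewrite E sK; lia.
have D' : [disjoint R :|: s @: R & F].
  rewrite disjoints_subset; apply/subsetP=> x; rewrite !inE.
  case/orP=> [xR|/imsetP[y]]; first by apply: contraTneq xR => ->; rewrite ltnn.
  by rewrite inE => yR ->; rewrite sK; apply: contraTneq yR => <-; rewrite ltnn.
have -> : #|T| = #|(R :|: s @: R) :|: F|.
  rewrite -cardsT; apply: eq_card => x; rewrite !inE; symmetry.
  case: (ltngtP (enum_rank x) (enum_rank (s x))) => //= [xR|E].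
    by apply/orP; left; apply/imsetP; exists (s x); rewrite ?inE ?sK.
  by rewrite -(enum_rank_inj (val_inj E)) eqxx orbT.
rewrite !cardsU !disjoint_setI0 // !cards0 !subn0 card_imset; last exact: inv_inj.
lia.
Qed.

(** A stable set is B :|: s @: B :|: C with B in R and C in F, and has 2|B| + |C| elements. Size 4
    leaves (|B|, |C|) = (2, 0), (1, 2) or (0, 4), one summand each. *)
Lemma card_stable_quadruples :
  #|[set A : {set T} | (#|A| == 4) && (s @: A == A)]|
  = 'C(#|R|, 2) + #|R| * 'C(#|F|, 2) + 'C(#|F|, 4).
Proof.
have sI : injective s by exact: inv_inj.
pose h (BC : {set T} * {set T}) := BC.1 :|: s @: BC.1 :|: BC.2.
have mems (A : {set T}) x : (x \in s @: A) = (s x \in A).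
  by rewrite -{1}(sK x) mem_imset.
pose Y (i j : nat) := setX [set B : {set T} | (B \subset R) && (#|B| == i)]
  [set C : {set T} | (C \subset F) && (#|C| == j)].
have cY i j : #|Y i j| = 'C(#|R|, i) * 'C(#|F|, j).
  by rewrite cardsX !cards_draws.
(* [hR] and [hF] recover B and C, which makes h injective; [hK] shows that h reaches every stable
   set. *)
have hR (B C : {set T}) : B \subset R -> C \subset F -> h (B, C) :&: R = B.
  move=> /subsetP sB /subsetP sC; apply/setP=> x; rewrite !inE mems.
  apply/andP/idP=> [[/orP[/orP[//|/sB]|/sC]]|xB]; rewrite ?inE ?sK.
  - by move=> H1 H2; move: (ltn_trans H1 H2); rewrite ltnn.
  - by move=> /eqP->; rewrite ltnn.
  - by rewrite xB; split=> //; move: (sB _ xB); rewrite inE.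
have hF (B C : {set T}) : B \subset R -> C \subset F -> h (B, C) :&: F = C.
  move=> /subsetP sB /subsetP sC; apply/setP=> x; rewrite !inE mems.
  apply/andP/idP=> [[/orP[/orP[/sB|/sB]|//]]|xC]; rewrite ?inE ?sK.
  - by move=> H1 /eqP E; move: H1; rewrite E ltnn.
  - by move=> H1 /eqP E; move: H1; rewrite E ltnn.
  - by rewrite xC orbT; split=> //; move: (sC _ xC); rewrite inE.
have hK (A : {set T}) : s @: A = A -> h (A :&: R, A :&: F) = A.
  move=> sA; have As x : (s x \in A) = (x \in A) by rewrite -mems sA.
  apply/setP=> x; rewrite !inE mems !inE As sK -!andb_orr.
  case: (x \in A) => //=; rewrite -(inj_eq enum_rank_inj) -val_eqE /=.
  by case: ltngtP.
have hs (B C : {set T}) : C \subset F -> s @: h (B, C) = h (B, C).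
  move=> /subsetP sC; apply/setP=> x; rewrite mems !inE !mems sK.
  rewrite [(s x \in B) || _]orbC; congr (_ || _).
  apply/idP/idP=> xC; move: (sC _ xC); rewrite inE ?sK => /eqP E.
    by rewrite E.
  by rewrite E.
have hc (B C : {set T}) : B \subset R -> C \subset F -> #|h (B, C)| = 2 * #|B| + #|C|.
  move=> sB sC; rewrite !cardsU card_imset //=.
  have -> : B :&: s @: B = set0.
    apply/setP=> x; rewrite !inE mems; apply/negP=> /andP[/(subsetP sB)+ /(subsetP sB)].
    by rewrite !inE sK => H1 H2; move: (ltn_trans H1 H2); rewrite ltnn.
  have -> : (B :|: s @: B) :&: C = set0.
    apply/setP=> x; rewrite !inE mems; apply/negP=> /andP[+ /(subsetP sC)].
    by rewrite inE => /orP[]/(subsetP sB); rewrite inE ?sK => + /eqP E; rewrite E ltnn.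
  rewrite cards0; lia.
have -> : [set A : {set T} | (#|A| == 4) && (s @: A == A)]
    = h @: (Y 2 0 :|: Y 1 2 :|: Y 0 4).
  apply/setP=> A; rewrite inE; apply/andP/imsetP=> [[/eqP A4 /eqP sA]|].
    exists (A :&: R, A :&: F); last by rewrite hK.
    move: (hc (A :&: R) (A :&: F) (subsetIr _ _) (subsetIr _ _)).
    rewrite !inE /= !subsetIr /= hK // A4; lia.
  case=> -[B C]; rewrite !inE /= => BC ->.
  have [sB sC] : B \subset R /\ C \subset F.
    by move: BC; do 2![case: (_ \subset _); rewrite ?andbF //].
  rewrite hs // eqxx hc //; split=> //.
  by move: BC; rewrite sB sC /=; lia.
rewrite card_in_imset.
  rewrite !cardsU !cY !bin0 !bin1.
  have -> : Y 2 0 :&: Y 1 2 = set0.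
    apply/setP=> -[B C]; rewrite !inE /=.
    by do 2![case: (_ \subset _); rewrite ?andbF //=]; lia.
  have -> : (Y 2 0 :|: Y 1 2) :&: Y 0 4 = set0.
    apply/setP=> -[B C]; rewrite !inE /=.
    by do 2![case: (_ \subset _); rewrite ?andbF //=]; lia.
  rewrite !cards0; lia.
move=> [B C] [B' C']; rewrite !inE /= => H H' E.
have [[sB sC] [sB' sC']] :
    (B \subset R /\ C \subset F) /\ (B' \subset R /\ C' \subset F).
  by split; [move: H | move: H']; do 2![case: (_ \subset _); rewrite ?andbF //].
by rewrite -(hR B C) // -{2}(hF B C) // E hR // hF.
Qed.

End Involution.

(** * The dihedral group acting on 4-subsets of Z/(m+2) *)

Section Dihedral.
Variable m : nat.
Local Notation I := 'I_m.+2.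

(** The modulus has the form [m.+2] so that the ordinals carry the ring structure of Z/(m+2). The
    boolean marks the reflections. *)
Definition dihedral_map (ba : bool * I) (x : I) : I :=
  (if ba.1 then ba.2 - x else ba.2 + x)%R.

Lemma dihedral_map_inj ba : injective (dihedral_map ba).
Proof.
by case: ba => -[] a x y /addrI // /oppr_inj.
Qed.

Definition dihedral_perm ba : {perm I} := perm (@dihedral_map_inj ba).

Definition dihedral : {set {perm I}} := [set dihedral_perm ba | ba : bool * I].

Lemma dihedral_group_set : group_set dihedral.
Proof.
apply/group_setP; split.
  apply/imsetP; exists (false, 0%R) => //; apply/permP=> x.
  by rewrite perm1 permE /dihedral_map /= add0r.
move=> _ _ /imsetP[[b a] _ ->] /imsetP[[c d] _ ->].
(* A product of permutations applies its left factor first, so its value at 0 is the image of a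
   under the right factor. *)
apply/imsetP; exists (b (+) c, dihedral_map (c, d) a) => //.
apply/permP=> x; rewrite permM !permE.
case: b; case: c; rewrite /dihedral_map //=; ring.
Qed.

Canonical dihedral_group := Group dihedral_group_set.

(** The value at 0 gives the translation part; the value at 1 then gives the sign, since 1 and -1
    differ for a modulus above 2. *)
Lemma dihedral_perm_inj : 0 < m -> injective dihedral_perm.
Proof.
move=> m0 [b a] [c d] /permP E; move: (E 0%R) (E 1%R).
rewrite !permE /dihedral_map /=.
have -> : (if b then a - 0 else a + 0)%R = a by case: (b); ring.
have -> : (if c then d - 0 else d + 0)%R = d by case: (c); ring.
move=> -> {E}; case: b; case: c => //= /addrI /(congr1 val) /=; rewrite !modn_small //; lia.
Qed.

(* Compare the sums of the elements of A and of a + A. *)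
Lemma stable_translation_torsion (a : I) (A : {set I}) :
  dihedral_map (false, a) @: A = A -> (a *+ #|A| = 0)%R.
Proof.
move=> aA; have E : (\sum_(x in A) x = a *+ #|A| + \sum_(x in A) x)%R.
  rewrite -{1}aA big_imset /=; last by move=> x y _ _; apply: dihedral_map_inj.
  by rewrite big_split /= sumr_const.
by apply: (addIr (\sum_(x in A) x)%R); rewrite -E add0r.
Qed.

Variable k : nat.
Hypothesis Nk : m.+2 = 2 * k.
Let half : I := inZp k.

Lemma val_half : val half = k.
Proof. rewrite /= modn_small //; lia. Qed.

Lemma half_neq0 : half != 0%R.
Proof. by rewrite -val_eqE val_half /=; lia. Qed.

Lemma double_eq0 (x : I) : (x + x == 0)%R = (x == 0%R) || (x == half).
Proof.
rewrite -!val_eqE val_half /=; have := ltn_ord x.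
case: (ltnP (x + x) m.+2) => [H|H] xN.
  rewrite modn_small //; lia.
have -> : x + x = (x + x - m.+2) + m.+2 by lia.
rewrite modnDr modn_small; lia.
Qed.

Lemma double_eq (b x : I) :
  (x + x == b + b)%R = (x \in [set b; b + half]%R).
Proof.
have -> : (x + x == b + b)%R = ((x - b) + (x - b) == 0)%R.
  by rewrite -subr_eq0; congr (_ == _); ring.
by rewrite double_eq0 !inE subr_eq0 [(_ == half)]subr_eq addrC.
Qed.

Lemma card_double_eq (b : I) : #|[set b; b + half]%R| = 2.
Proof.
by rewrite cards2 -[X in X != _]addr0 (inj_eq (addrI b)) eq_sym half_neq0.
Qed.

(** With r two-element orbits and f fixed points, 2k = 2r + f. If f = 0 then r = k; if f = 2 then r
    = k - 1, and C(k-1, 2) + (k-1) = C(k, 2) by Pascal's rule. *)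
Lemma card_stable_involution ba :
  #|[set x | dihedral_map ba x == x]| \in [:: 0; 2] ->
  involutive (dihedral_map ba) ->
  #|[set A : {set I} | (#|A| == 4) && (dihedral_map ba @: A == A)]| = 'C(k, 2).
Proof.
move=> + inv; rewrite (card_stable_quadruples inv).
move: (card_involution inv).
move: #|[set x | enum_rank x < _]| => r; move: #|[set x | dihedral_map ba x == x]| => f.
rewrite card_ord Nk => + F; move: F; rewrite !inE => /orP[]/eqP-> E.
  rewrite !bin0n muln0 !addn0; congr 'C(_, _); lia.
rewrite binn (@bin_small 2 4) // addn0 muln1.
have -> : k = r.+1 by lia.
by rewrite binS bin1.
Qed.

(** The fixed points solve 2x = a: there are none, or exactly b and b + k for some solution b. *)
Lemma card_stable_reflection (a : I) :
  #|[set A : {set I} | (#|A| == 4) && (dihedral_map (true, a) @: A == A)]|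
  = 'C(k, 2).
Proof.
apply: card_stable_involution; last first.
  by move=> x; rewrite /dihedral_map /=; ring.
have [->|[b]] := set_0Vmem [set x | dihedral_map (true, a) x == x].
  by rewrite cards0.
rewrite inE /dihedral_map /= => /eqP E.
have -> : [set x : I | a - x == x]%R = [set b; b + half]%R.
  apply/setP=> x; rewrite inE -double_eq.
  have -> : a = (b + b)%R by rewrite -{1}E subrK.
  by rewrite subr_eq eq_sym.
by rewrite card_double_eq.
Qed.

Lemma card_stable_half :
  #|[set A : {set I} | (#|A| == 4) && (dihedral_map (false, half) @: A == A)]|
  = 'C(k, 2).
Proof.
have hh : (half + half = 0)%R by apply/eqP; rewrite double_eq0 eqxx orbT.
apply: card_stable_involution; last first.
  by move=> x; rewrite /dihedral_map /= addrA hh add0r.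
have -> : [set x | dihedral_map (false, half) x == x] = set0.
  apply/setP=> x; rewrite !inE /dihedral_map /=.
  by rewrite -subr_eq0 addrK (negbTE half_neq0).
by rewrite cards0.
Qed.

(** Here a has order exactly 4, so the stable quadruples are the cosets [O x] of the subgroup it
    generates, and these partition Z/2k into blocks of size 4. *)
Lemma card_stable_quarter (a : I) :
  (a + a != 0)%R -> (a *+ 4 = 0)%R ->
  #|[set A : {set I} | (#|A| == 4) && (dihedral_map (false, a) @: A == A)]| * 4
  = 2 * k.
Proof.
move=> a2 a4; set P := [set A | _].
pose O x := [set x; a + x; a + a + x; a + a + a + x]%R.
have a1 : (a != 0)%R by apply: contraNneq a2 => ->; rewrite addr0.
have a3 : (a + a + a != 0)%R.
  apply: contraNneq a2 => E; have : (a *+ 4 = a + a + a + a)%R by ring.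
  by rewrite a4 E add0r => <-; rewrite addr0.
have cO x : #|O x| = 4.
  have nz (b c : I) : (b != 0 -> c + b + x != c + x)%R.
    move=> b0; apply: contraNneq b0 => E; apply/eqP/(addrI c)/(addIr x).
    by rewrite E addr0.
  have := nz _ 0%R a1; have := nz _ 0%R a2; have := nz _ 0%R a3.
  have := nz _ a a1; have := nz _ a a2; have := nz _ (a + a)%R a1.
  rewrite !add0r !addrA => H1 H2 H3 H4 H5 H6.
  rewrite /O -!setUA !cardsU1 cards1 !inE ![x == _]eq_sym.
  rewrite (negbTE H4) (negbTE H5) (negbTE H6) ![(a + x == _)%R]eq_sym.
  by rewrite (negbTE H2) (negbTE H3) eq_sym (negbTE H1).
have stab (A : {set I}) x : A \in P -> x \in A -> A = O x.
  rewrite inE => /andP[/eqP A4 /eqP aA] xA.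
  have st y : y \in A -> (a + y)%R \in A.
    by move=> yA; rewrite -aA; apply/imsetP; exists y.
  apply/eqP; rewrite eq_sym eqEcard cO A4 leqnn andbT.
  apply/subsetP=> y; rewrite !inE -!orbA => /or4P[]/eqP->; rewrite -?addrA; auto.
have OP x : O x \in P.
  rewrite inE cO eqxx /= eqEcard card_imset ?leqnn ?andbT; last exact: dihedral_map_inj.
  apply/subsetP=> _ /imsetP[y + ->]; rewrite /dihedral_map /= !inE -!orbA.
  have a4x : (a + (a + a + a + x) = x)%R by rewrite -[RHS]add0r -a4; ring.
  by case/or4P=> /eqP->; rewrite ?a4x ?addrA ?eqxx ?orbT.
have <- : #|[set: I]| = 2 * k by rewrite cardsT card_ord.
symmetry; apply: card_uniform_partition.
  by move=> A; rewrite inE => /andP[/eqP].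
apply/and3P; split.
- apply/eqP/setP=> x; rewrite inE; apply/bigcupP; exists (O x) => //.
  by rewrite !inE eqxx.
- apply/trivIsetP=> A B AP BP; apply: contraR => /pred0Pn[x /andP[xA xB]].
  by rewrite (stab A x) // -(stab B x).
- by rewrite inE cards0.
Qed.

(** The condition says that 2a is the nonzero solution of 2y = 0, that is 2a = k modulo 2k. For even
    k the solutions are k/2 and k/2 + k. *)
Lemma card_quarter_turns :
  #|[set a : I | (a + a != 0)%R && (a *+ 4 == 0)%R]| = 2 * ~~ odd k.
Proof.
have -> : [set a : I | (a + a != 0)%R && (a *+ 4 == 0)%R]
    = [set a | (a + a == half)%R].
  apply/setP=> a; rewrite !inE.
  have -> : (a *+ 4 = (a + a) + (a + a))%R by ring.
  move: (a + a)%R => y; rewrite double_eq0; case: eqP => [->|] //=.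
  by rewrite eq_sym (negbTE half_neq0).
have [k_odd|k_even] := boolP (odd k).
  apply/eqP; rewrite cards_eq0; apply/eqP/setP=> a.
  rewrite !inE -val_eqE val_half /=; apply/eqP=> E.
  have N_even : odd m.+2 = false by rewrite Nk mul2n odd_double.
  (* The even integer a + a would be a multiple of 2k plus the odd number k. *)
  have := congr1 odd (divn_eq (a + a) m.+2).
  by rewrite E !oddD oddM N_even andbF k_odd addbb.
pose b : I := inZp k./2.
suff -> : half = (b + b)%R.
  rewrite muln1 -[RHS](card_double_eq b); congr #|pred_of_set _|.
  by apply/setP=> x; rewrite inE double_eq.
apply: val_inj; rewrite val_half /= modn_small; rewrite (@modn_small k./2); lia.
Qed.

Hypothesis k1 : 1 < k.

Definition quadruples := [set A : {set I} | #|A| == 4].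

Lemma card_fixed_quadruples ba :
  #|'Fix_(quadruples | 'P^*)[dihedral_perm ba]%g|
  = #|[set A : {set I} | (#|A| == 4) && (dihedral_map ba @: A == A)]|.
Proof.
apply: eq_card => A; rewrite !inE sub1set inE; congr (_ && _).
congr (_ == _); rewrite /setact /=; apply: eq_imset => x.
by rewrite /= apermE permE.
Qed.

(** The three terms come from a = 0, from the half turn and from the quarter turns. If 4a is
    nonzero, no quadruple is stable, by [stable_translation_torsion]. *)
Lemma sum_stable_translations :
  \sum_(a : I)
    #|[set A : {set I} | (#|A| == 4) && (dihedral_map (false, a) @: A == A)]|
  = 'C(2 * k, 4) + 'C(k, 2) + k * ~~ odd k.
Proof.
rewrite (bigD1 0%R) //= (bigD1 half) ?half_neq0 //= card_stable_half addnA.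
congr (_ + _ + _).
  rewrite -Nk -[X in 'C(X, _)](card_ord m.+2) -cardsT -cards_draws.
  apply: eq_card => A; rewrite !inE subsetT /= /dihedral_map /=.
  by rewrite (eq_imset _ (@add0r _)) imset_id eqxx andbT.
apply/eqP; rewrite -(eqn_pmul2r (isT : 0 < 4)); apply/eqP.
rewrite big_distrl /= (eq_bigl (fun a : I => (a + a != 0)%R)); last first.
  by move=> a; rewrite double_eq0 negb_or.
rewrite (bigID (fun a : I => a *+ 4 == 0)%R) /= [X in _ + X]big1 ?addn0.
  rewrite (eq_bigr (fun=> 2 * k)); last first.
    by move=> a /andP[a2 /eqP a4]; apply: card_stable_quarter.
  rewrite sum_nat_cond_const card_quarter_turns; lia.
move=> a /andP[_ a4]; apply/eqP; rewrite muln_eq0 cards_eq0 orbF.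
apply: contraNT a4 => /set0Pn[A].
rewrite inE => /andP[/eqP A4 /eqP /stable_translation_torsion].
by rewrite A4 => ->.
Qed.

(** Burnside's lemma for a group of order 4k. The 2k reflections and the half turn together account
    for the factor 2k + 1. *)
Lemma card_quadruple_orbits :
  #|orbit 'P^* dihedral @: quadruples| * (4 * k)
  = 'C(2 * k, 4) + (2 * k + 1) * 'C(k, 2) + k * ~~ odd k.
Proof.
have m0 : 0 < m by lia.
have act : [acts dihedral, on quadruples | 'P^*].
  apply/actsP=> p _ A; rewrite !inE /= card_imset //; exact: act_inj.
have cG : #|dihedral| = 4 * k.
  rewrite card_imset; last exact: dihedral_perm_inj.
  by rewrite card_prod card_bool card_ord Nk; lia.
have := Frobenius_Cauchy act; rewrite [#|dihedral_group|]cG => <-.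
rewrite big_imset /=; last by move=> ? ? _ _; apply: dihedral_perm_inj.
under eq_bigr do rewrite card_fixed_quadruples.
rewrite -(pair_bigA _ (fun b a => #|[set A : {set I} |
  (#|A| == 4) && (dihedral_map (b, a) @: A == A)]|)) /= big_bool /=.
rewrite sum_stable_translations (eq_bigr (fun=> 'C(k, 2))); last first.
  by move=> a _; apply: card_stable_reflection.
rewrite sum_nat_const card_ord Nk; lia.
Qed.

End Dihedral.

(** * Triangle signs as switching invariants *)

Section Triangles.
Variable G : graph.
Implicit Types (s : signature G) (x y z u : G).

Lemma pair_edges x y : adj x y -> [set x; y] \in edges G.
Proof. by move=> xy; apply/imsetP; exists (x, y); rewrite ?inE. Qed.

Definition edge_of x y (xy : adj x y) : edge G :=
  exist (fun e => e \in edges G) _ (pair_edges xy).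

Lemma edgeP (e : edge G) : exists x y, adj x y /\ val e = [set x; y].
Proof.
have /imsetP[[x y]] := valP e; rewrite inE => xy E.
by exists x, y.
Qed.

(* [sign_of s x y] is [false] if x and y are not adjacent. *)
Definition sign_of s x y : bool := oapp s false (insub [set x; y]).

Lemma sign_ofE s (e : edge G) x y : val e = [set x; y] -> sign_of s x y = s e.
Proof. by move=> E; rewrite /sign_of -E valK. Qed.

(** Adjacent vertices are distinct, so u lies on the edge exactly when the exclusive or of the two
    equalities holds. *)
Lemma sign_of_switch s u x y : adj x y ->
  sign_of (switch u s) x y = sign_of s x y (+) (u == x) (+) (u == y).
Proof.
move=> xy; pose e := edge_of xy.
rewrite !(@sign_ofE _ e) // ffunE /= !inE.
have : x != y by apply: contraTneq (xy) => ->; rewrite adj_irr.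
case: (eqVneq u x) => [->|_] /=; last by case: (u == y); case: (s e).
by move/negbTE->; case: (s e).
Qed.

Definition triangle_sign s x y z :=
  sign_of s x y (+) sign_of s y z (+) sign_of s x z.

(** Each vertex of a triangle lies on exactly two of its edges, so the two sign changes made by a
    switching cancel. *)
Lemma triangle_sign_switching_equivalent s t x y z :
  adj x y -> adj y z -> adj x z -> switching_equivalent s t ->
  triangle_sign t x y z = triangle_sign s x y z.
Proof.
move=> xy yz xz /connectP[p]; elim: p s => [|t1 p IH] s /= => [_ -> //|].
move=> /andP[/existsP[u /eqP E] tp] tE; rewrite (IH t1) // E.
rewrite /triangle_sign !sign_of_switch //.
by case: (u == x); case: (u == y); case: (u == z);
  do 3![case: (sign_of _ _ _)].
Qed.

End Triangles.

Lemma sign_of_iso (G H : graph) (s : signature G) (t : signature H) f x y :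
  is_signed_iso s t f -> adj x y -> sign_of t (f x) (f y) = sign_of s x y.
Proof.
case/is_signed_isoP=> _ fa fe xy.
have fxy : adj (f x) (f y) by rewrite fa.
pose e := edge_of xy.
pose e' := edge_of fxy.
rewrite (@sign_ofE _ _ e) // (@sign_ofE _ _ e') //.
by apply: fe; rewrite /= imsetU1 imset_set1.
Qed.

(** * From outer signed wheels to dihedral orbits *)

Section Wheel.
Variable m : nat.
Hypothesis m_gt1 : 1 < m.
Local Notation I := 'I_m.+2.
Local Notation W := (wheel m.+2).
Implicit Types s t : signature W.

Lemma ordS_add1 (i : I) : ordS i = (i + 1)%R.
Proof. by apply: val_inj; rewrite /= (@modn_small 1) // addn1. Qed.

(** The modulus is at least 4. This separates nearby rim vertices, and it is what distinguishes the
    hub from the rim. *)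
Lemma nat_neq0 j : 0 < j < 4 -> (j%:R != 0 :> I)%R.
Proof.
move=> j4; rewrite Zp_nat -val_eqE /= modn_small; lia.
Qed.

Lemma add1_neq (i : I) : (i == i + 1)%R = false.
Proof.
by rewrite -[X in X == _]addr0 (inj_eq (addrI i)) eq_sym (negbTE (@nat_neq0 1 _)).
Qed.

Lemma rim_adj (i : I) : @adj W (Some i) (Some (ordS i)).
Proof. by rewrite /= ordS_add1 add1_neq eqxx. Qed.

Definition rim (i : I) : edge W := edge_of (rim_adj i).

Lemma val_rim i : val (rim i) = [set Some i; Some (i + 1)%R].
Proof. by rewrite /= ordS_add1. Qed.

(** If i and j differ but {i, i+1} = {j, j+1}, then i = j + 1 and j = i + 1, whence 2 = 0. *)
Lemma rim_inj : injective rim.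
Proof.
move=> i j /(congr1 val); rewrite !val_rim => /setP E.
move: (E (Some i)) (E (Some j)) ; rewrite !inE !eqxx /= !(inj_eq Some_inj).
rewrite [j == i]eq_sym; case: (eqVneq i j) => //= _ /esym/eqP ij /eqP ji.
case/eqP: (@nat_neq0 2 isT); apply: (addrI j).
by rewrite addr0 [in RHS]ji ij; ring.
Qed.

Definition negative_rim s : {set I} := [set i | s (rim i)].

Definition outer s := [forall e in negative_edges s, val e \in outer_cycle m.+2].

Lemma outer_cycleE (e : edge W) :
  (val e \in outer_cycle m.+2) = [exists i, e == rim i].
Proof.
apply/imsetP/existsP=> [[i _ E]|[i /eqP->]]; last by exists i.
by exists i; apply/eqP/val_inj; rewrite E.
Qed.

Lemma outer_hub s (e : edge W) : outer s -> None \in val e -> s e = false.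
Proof.
move=> /forall_inP/(_ e) so Ne; apply/negP=> se.
have := so; rewrite inE outer_cycleE => /(_ se) /existsP[i /eqP Ei].
by move: Ne; rewrite Ei val_rim !inE.
Qed.

Lemma negative_edges_outer s :
  outer s -> negative_edges s = rim @: negative_rim s.
Proof.
move=> so; apply/setP=> e; apply/idP/imsetP=> [es|[i + ->]]; last by rewrite !inE.
have := forall_inP so e es; rewrite outer_cycleE => /existsP[i /eqP Ei].
by exists i; rewrite // inE -Ei; rewrite inE in es.
Qed.

Lemma negative_rim_outer_signed_wheels :
  negative_rim @: outer_signed_wheels 4 m.+2 = quadruples m.
Proof.
apply/setP=> A; rewrite inE; apply/imsetP/idP=> [[s]|A4].
  rewrite inE => /andP[/eqP s4 so] ->.
  by rewrite -s4 (negative_edges_outer so) (card_imset _ rim_inj).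
pose s : signature W := [ffun e => e \in rim @: A].
have neg : negative_edges s = rim @: A by apply/setP=> e; rewrite inE ffunE.
exists s; last by apply/setP=> i; rewrite inE ffunE (mem_imset _ _ rim_inj).
rewrite inE neg (card_imset _ rim_inj) A4 /=.
apply/forall_inP=> _ /imsetP[i _ ->]; rewrite outer_cycleE.
by apply/existsP; exists i.
Qed.

(** Each step p(j+1) - p(j) is 1 or -1. A change of sign would give p(j+2) = p(j), against
    injectivity, so the step is a constant c and p(x) = p(0) + cx. *)
Lemma cycle_map_dihedral (p : I -> I) : injective p ->
  (forall i, (p (i + 1) == p i + 1) || (p i == p (i + 1) + 1))%R ->
  exists ba, p =1 dihedral_map ba.
Proof.
move=> pI p1; pose c := (p 1 - p 0)%R.
have stepc j : (p j.+1%:R = p j%:R + c)%R.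
  elim: j => [|j IH]; first by rewrite /c addrC subrK.
  have pE : (p j.+2%:R != p j%:R)%R.
    rewrite (inj_eq pI) -subr_eq0 -natrB; last by lia.
    by rewrite (_ : j.+2 - j = 2) ?nat_neq0 //; lia.
  have : (c == 1)%R || (c == -1)%R.
    have := p1 0%R; rewrite add0r /c => /orP[]/eqP->.
      by rewrite addrAC subrr add0r eqxx.
    by apply/orP; right; apply/eqP; ring.
  have := p1 (j.+1%:R)%R; rewrite natr1 => /orP[]/eqP E /orP[]/eqP Ec.
  - by rewrite E Ec.
  - by case/negP: pE; rewrite E IH Ec subrK.
  - by case/negP: pE; rewrite -(inj_eq (addIr 1%R)) -E IH Ec.
  - by rewrite Ec E addrK.
have pc x : (p x = p 0 + c * x)%R.
  rewrite -[x]natr_Zp; elim: (val x) => [|j IH]; first by rewrite mulr0 addr0.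
  rewrite stepc IH -natr1; ring.
have : (c == 1)%R || (c == -1)%R.
  have := p1 0%R; rewrite add0r /c => /orP[]/eqP->.
    by rewrite addrAC subrr add0r eqxx.
  by apply/orP; right; apply/eqP; ring.
case/orP=> /eqP Ec; [exists (false, p 0%R) | exists (true, p 0%R)] => x;
  by rewrite pc Ec /dihedral_map /= ?mul1r ?mulN1r.
Qed.

Lemma wheel_adj_some (i j : I) : @adj W (Some i) (Some j) =
  ((j == i + 1) || (i == j + 1))%R.
Proof.
rewrite /= !ordS_add1; case: eqVneq => [->|] //=.
by rewrite add1_neq.
Qed.

(** The image of the hub is adjacent to all other vertices, whereas a rim vertex j is not adjacent
    to j + 2. *)
Lemma wheel_aut_hub (f : W -> W) : bijective f ->
  (forall x y, adj (f x) (f y) = adj x y) -> f None = None.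
Proof.
case=> g fK gK fa; case E: (f None) => [j|] //.
have jadj y : y != Some j -> @adj W (Some j) y.
  move=> yj; rewrite -E -(gK y) fa; case Eg: (g y) => [i|] //.
  by move: yj; rewrite -(gK y) Eg E eqxx.
have ne i : 0 < i < 4 -> (j + i%:R == j)%R = false.
  by move=> i4; rewrite -[RHS](negbTE (nat_neq0 i4)) -subr_eq0 addrAC subrr add0r.
have n2 : (j + 1 + 1 == j)%R = false.
  by rewrite -(ne 2) //; congr (_ == _); ring.
have n3 : (j == j + 1 + 1 + 1)%R = false.
  by rewrite eq_sym -(ne 3) //; congr (_ == _); ring.
have := jadj (Some (j + 1 + 1)%R).
rewrite wheel_adj_some (inj_eq Some_inj) n2 n3 orbF => /(_ isT).
by rewrite eq_sym add1_neq.
Qed.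

(** Hub triangles carry the rim signs through the switching, and the isomorphism fixes the hub, so
    it permutes the rim edges dihedrally. Conversely, a dihedral map of the rim edges comes from an
    automorphism of the wheel, and no switching is made. *)
Lemma switching_isomorphic_outer s t : outer s -> outer t ->
  switching_isomorphic s t =
  (negative_rim t \in orbit 'P^* (dihedral m) (negative_rim s)).
Proof.
move=> so to.
(* Both spokes of the triangle are positive, which leaves the sign of the rim edge. *)
have tri u i : outer u ->
    @triangle_sign W u None (Some i) (Some (ordS i)) = u (rim i).
  move=> uo.
  have hub j : @sign_of W u None (Some j) = false.
    have Nj : @adj W None (Some j) by [].
    rewrite (@sign_ofE W u (edge_of Nj)) // outer_hub //=.
    by rewrite !inE.
  by rewrite /triangle_sign !hub (@sign_ofE W u (rim i)) // addbF.
apply/existsP/orbitP.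
  move=> [s' /andP[ss' /existsP[f fiso]]].
  have /is_signed_isoP[fb fa _] := fiso.
  have fN := wheel_aut_hub fb fa.
  have fI := bij_inj fb.
  (* The default 0 is never taken: f is injective and already sends the hub to [None]. *)
  pose p (i : I) : I := odflt 0%R (f (Some i) : option I).
  have fp i : f (Some i) = Some (p i).
    rewrite /p; case E: (f (Some i)) => [j|] //.
    by rewrite -fN in E; move/fI: E.
  have pI : injective p by move=> i j E; apply/Some_inj/fI; rewrite !fp E.
  have p1 i : ((p (i + 1) == p i + 1) || (p i == p (i + 1) + 1))%R.
    by rewrite -wheel_adj_some -!fp fa wheel_adj_some eqxx.
  have [[b a] pb] := cycle_map_dihedral pI p1.
  pose q := dihedral_map (b, if b then (a - 1)%R else a).
  have qrim i : val (rim (q i)) = [set Some (p i); Some (p (i + 1))%R].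
    rewrite val_rim !pb /q /dihedral_map; case: (b) => /=.
      rewrite setUC; congr [set Some _; Some _]; ring.
    by congr [set Some _; Some _]; ring.
  (* Rim edge i joins i to i + 1, so x |-> a - x on the vertices induces
     i |-> a - 1 - i on the rim edges. *)
  exists (dihedral_perm (b, if b then (a - 1)%R else a)).
    exact: imset_f.
  have qst i : t (rim (q i)) = s (rim i).
    rewrite -(tri s) // -(triangle_sign_switching_equivalent _ _ _ ss') ?rim_adj //.
    rewrite -(sign_ofE t (qrim i)) /triangle_sign.
    rewrite -!(sign_of_iso fiso) ?rim_adj // fN !fp.
    have hub j : @sign_of W t None (Some j) = false.
      have Nj : @adj W None (Some j) by [].
      rewrite (@sign_ofE W t (edge_of Nj)) // outer_hub //=.
      by rewrite !inE.
    by rewrite !hub addbF ordS_add1.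
  apply/setP=> i; rewrite inE.
  have [g _ gK] : bijective q by apply: injF_bij; apply: dihedral_map_inj.
  rewrite -(gK i) qst /setact /=; apply/imsetP/idP=> [[j + ]|H].
    by rewrite /= apermE permE => + /dihedral_map_inj->; rewrite inE.
  by exists (g i); rewrite ?inE //= apermE permE.
move=> [_ /imsetP[[b a] _ ->] st]; exists s.
apply/andP; split; first exact: connect0.
(* The opposite shift: i |-> a - i on the rim edges is induced by x |-> a + 1 - x on the
   vertices. *)
pose p := dihedral_map (b, if b then (a + 1)%R else a).
have pI : injective p by apply: dihedral_map_inj.
apply/existsP; exists [ffun x => omap p x].
apply/is_signed_isoP; split.
- apply: injF_bij => -[i|] [j|]; rewrite !ffunE //=.
  by move/Some_inj/pI->.
- move=> [i|] [j|]; rewrite !ffunE //; rewrite !wheel_adj_some /p /dihedral_map.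
  have subE (u v u' v' : I) : (u - v = u' - v')%R -> (u == v) = (u' == v').
    by move=> E; rewrite -subr_eq0 E subr_eq0.
  case: (b) => /=; first rewrite orbC.
    by congr (_ || _); apply: subE; ring.
  by congr (_ || _); apply: subE; ring.
- move=> e e' E.
  have [Ne|Ne] := boolP (None \in val e).
    rewrite !outer_hub // E; apply/imsetP; exists None => //.
    by rewrite ffunE.
  have [i Ei] : exists i, e = rim i.
    have [[i|] [[j|] [ij Ee]]] := edgeP e; last 3 first.
    - by move: Ne; rewrite Ee !inE orbT.
    - by move: Ne; rewrite Ee !inE.
    - by move: Ne; rewrite Ee !inE.
    move: ij; rewrite wheel_adj_some => /orP[]/eqP E1; subst.
      by exists i; apply: val_inj; rewrite val_rim.
    by exists j; apply: val_inj; rewrite val_rim setUC.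
  subst e.
  have -> : e' = rim (dihedral_map (b, a) i).
    apply: val_inj; rewrite E !val_rim imsetU1 imset_set1 !ffunE /= /p /dihedral_map.
    case: (b) => /=.
      rewrite setUC; congr [set Some _; Some _]; ring.
    by congr [set Some _; Some _]; ring.
  have : (dihedral_map (b, a) i \in negative_rim t) = (i \in negative_rim s).
    rewrite -st /setact /=; apply/imsetP/idP=> [[j + ]|H].
      by rewrite /= apermE permE => + /dihedral_map_inj->.
    by exists i; rewrite //= apermE permE.
  by rewrite !inE.
Qed.

(** Sending a signature to its class and sending it to the orbit of its negative rim have the same
    fibres on [X], hence images of the same size. *)
Lemma psi_quadruple_orbits :
  psi 4 m.+2 = #|orbit 'P^* (dihedral m) @: quadruples m|.
Proof.
rewrite -negative_rim_outer_signed_wheels -imset_comp /psi.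
set X := outer_signed_wheels 4 m.+2.
have Xo s : s \in X -> outer s by rewrite inE => /andP[].
have E s t : s \in X -> t \in X -> switching_isomorphic s t =
    (orbit 'P^* (dihedral m) (negative_rim s)
     == orbit 'P^* (dihedral m) (negative_rim t)).
  move=> /Xo so /Xo to; rewrite switching_isomorphic_outer //.
  by apply/orbit_eqP/eqP=> ->.
apply/eqP; rewrite eqn_leq !leq_card_imset_fibers //= => s t sX tX st.
  apply/eqP; rewrite -E //.
  have : t \in [set u in X | @switching_isomorphic W W s u].
    by rewrite st in_set tX switching_isomorphic_refl.
  by rewrite in_set => /andP[].
apply/setP=> u; rewrite [LHS]in_set [RHS]in_set; apply: andb_id2l => uX.
by rewrite !E // st.
Qed.

End Wheel.

(** * Evaluation of the count *)

Lemma psi4_even k : 1 < k ->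
  psi 4 (2 * k) * (4 * k)
  = 'C(2 * k, 4) + (2 * k + 1) * 'C(k, 2) + k * ~~ odd k.
Proof.
move=> k1; have [m Nk] : exists m, m.+2 = 2 * k by exists (2 * k - 2); lia.
have m1 : 1 < m by lia.
by rewrite -(card_quadruple_orbits Nk k1) -Nk psi_quadruple_orbits.
Qed.

Local Open Scope ring_scope.

Lemma bin2_rat k : ('C(k, 2))%:R = k%:R * (k%:R - 1) / 2 :> rat.
Proof.
have : ('C(k, 2) * 2 + k = k * k)%N.
  rewrite bin2; have := odd_double_half (k * k.-1).
  by rewrite oddM; case: k => [|k] //=; lia.
move=> /(congr1 (fun j => j%:R : rat)); rewrite natrD !natrM => E.
lra.
Qed.

Lemma bin4_rat n : (3 < n)%N ->
  ('C(n, 4))%:R = n%:R * (n%:R - 1) * (n%:R - 2) * (n%:R - 3) / 24 :> rat.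
Proof.
case: n => [|[|[|[|n]]]] // _; have := bin_ffact n.+4 4.
rewrite !ffactnS ffactn0 /= muln1 => /(congr1 (fun j => j%:R : rat)).
rewrite !natrM => E.
have -> : ('C(n.+4, 4))%:R = ('C(n.+4, 4))%:R * (4`!)%:R / 24 :> rat.
  by rewrite [(4`!)%:R]/(24 : rat); field.
rewrite E -addn4 -addn3 -addn2 -addn1 !natrD; field=> //.
Qed.

Theorem theorem3p1 (n k l : nat) (hn : n = (2 * k)%N) (hk : (2 <= k)%N)
    (hl : l = ((n - 4) %/ 4)%N) :
  (psi 4 (2 * k))%:R =
    (l%:R + 1) * k%:R ^+ 2 - (2 * l%:R + 3) * (l%:R + 1) * k%:R
    + (4 * l%:R ^+ 3 + 15 * l%:R ^+ 2 + 20 * l%:R + 9) / 3 :> rat.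
Proof.
have k0 : k%:R != 0 :> rat by rewrite pnatr_eq0; lia.
have /(congr1 (fun j => j%:R : rat)) := psi4_even hk.
rewrite !natrD !natrM natrD natrM bin2_rat bin4_rat; last by lia.
rewrite natrM => E; apply: (@mulIf _ (4 * k%:R)); first by rewrite mulf_neq0.
(* Since l is the integer part of (k - 2)/2, k is 2l + 3 or 2l + 2 according to its parity. Both
   sides are then polynomials in l, and the parity term is 0 or k. *)
rewrite {}E; have [k_odd|k_even] := boolP (odd k).
  have -> : k = (2 * l + 3)%N by lia.
  by rewrite natrD natrM mulr0; field.
have -> : k = (2 * l + 2)%N by lia.
by rewrite natrD natrM mulr1; field.
Qed.
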